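(* Let $H\in\mathbb{C}^{M\times N}$, $M\ge N$, let $E_s,N_0>0$, $\alpha=N_0/E_s$, and $1\le\nu\le N-1$. Let $y=Hx+n$ with $x\sim\mathcal{CN}(0,E_sI_N)$ and $n\sim\mathcal{CN}(0,N_0I_M)$ independent. Let $L_{ap}$ be the punctured augmented matrix of order $\nu$ associated with $H$ (see context), let $\mathbf{M}=H^\dagger(HH^\dagger+\alpha I_M)^{-1}$, $G_{ap}=L_{ap}^\dagger L_{ap}$, $F_{ap}=\mathbf{M}^\dagger G_{ap}$, and define the augmented WLD (AWLD) detection model $$p_{ap}(y|x)=\exp\!\Big(2\,\mathrm{Re}\{y^\dagger F_{ap}x\}-x^\dagger G_{ap}x+\tfrac1{E_s}x^\dagger x\Big),\qquad p_{ap}(y)=\int_{\mathbb{C}^N}p_{ap}(y|x)p(x)\,dx,$$ where $p(x)=\frac{1}{\pi^NE_s^N}\exp(-\|x\|^2/E_s)$. Then the lower bound on the achievable information rate of the AWLD detector, $$I_{LB}^{AWLD}=\mathsf{E}_{Y,X}[\ln p_{ap}(y|x)]-\mathsf{E}_Y[\ln p_{ap}(y)],$$ equals $$I_{LB}^{AWLD}=N\ln E_s+\ln\det\!\big(L_{ap}^\dagger L_{ap}\big).$$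
   Context: $(\cdot)^\dagger$ is the conjugate transpose; $\mathcal{CN}$ is the circularly-symmetric complex Gaussian distribution; expectations are over the true joint law of $(x,y)$ with $H$ fixed. $\mathrm{diag}(A)$ denotes the diagonal matrix with the same diagonal entries as $A$. Punctured augmented matrix: let $H_a=\begin{bmatrix}\frac1{\sqrt{N_0}}H\\ \frac1{\sqrt{E_s}}I_N\end{bmatrix}$ (size $(M+N)\times N$), and let $H_a=Q_aL_a$ be its thin QL decomposition: $Q_a$ is $(M+N)\times N$ with $Q_a^\dagger Q_a=I_N$, and $L_a$ is $N\times N$ lower triangular with real positive diagonal entries. Partition $L_a=\begin{bmatrix}P_a&0\\R_a&S_a\end{bmatrix}$ with $P_a$ of size $\nu\times\nu$ and $S_a$ of size $(N-\nu)\times(N-\nu)$. Put $\Omega_a=\mathrm{diag}(S_a^{-1}S_a^{-\dagger})^{-1/2}$, $W_{ap}=\begin{bmatrix}I_\nu&0\\0&\Omega_aS_a^{-1}\end{bmatrix}$, and $$L_{ap}=W_{ap}L_a=\begin{bmatrix}P_a&0\\ \Omega_aS_a^{-1}R_a&\Omega_a\end{bmatrix}.$$ *)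

(* Defs.v *)
From HB Require Import structures.
From mathcomp Require Import all_boot all_order all_algebra.
From mathcomp Require Import complex.
From mathcomp Require Import all_classical all_reals all_analysis.

Set Implicit Arguments.
Unset Strict Implicit.
Unset Printing Implicit Defensive.

Import Order.TTheory GRing.Theory Num.Theory.
Import numFieldNormedType.Exports.

Local Open Scope classical_set_scope.
Local Open Scope ring_scope.
Local Open Scope complex_scope.
Local Open Scope sesquilinear_scope.

Section product_sigma_finite.
Context d1 d2 (T1 : measurableType d1) (T2 : measurableType d2) (R : realType).
Variables (m1 : {sigma_finite_measure set T1 -> \bar R})
  (m2 : {sigma_finite_measure set T2 -> \bar R}).

Lemma product_sigma_finite : sigma_finite setT (m1 \x m2)%E.
Proof.
have /sigma_finiteP[F [TF ndF Foo]] := sigma_finiteT m1.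
have /sigma_finiteP[G [TG ndG Goo]] := sigma_finiteT m2.
exists (fun n => F n `*` G n).
  rewrite -setXTT TF TG predeqE => -[x y]; split.
    move=> [/= [n _ Fnx] [k _ Gky]]; exists (maxn n k) => //; split.
    - by move: x Fnx; exact/subsetPset/ndF/leq_maxl.
    - by move: y Gky; exact/subsetPset/ndG/leq_maxr.
  by move=> [n _ []/= ? ?]; split; exists n.
move=> k; have [? ?] := Foo k; have [? ?] := Goo k.
split; first exact: measurableX.
by rewrite product_measure1E// lte_mul_pinfty// ge0_fin_numE.
Qed.

End product_sigma_finite.

Section power_measure.
Context d (T : measurableType d) (R : realType).
Local Open Scope ereal_scope.

Definition tcons n (p : T * n.-tuple T) : n.+1.-tuple T :=
  [the n.+1.-tuple T of p.1 :: p.2].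

Lemma measurable_tcons n : measurable_fun [set: T * n.-tuple T] (@tcons n).
Proof. exact: measurable_cons. Qed.

Let tuncons n (t : n.+1.-tuple T) : T * n.-tuple T :=
  (thead t, [tuple of behead t]).

Let tunconsK n : cancel (@tuncons n) (@tcons n).
Proof. by move=> t; rewrite [RHS]tuple_eta; apply/val_inj. Qed.

Let tconsK n : cancel (@tcons n) (@tuncons n).
Proof. by case=> x t; congr pair; apply/val_inj. Qed.

Let measurable_tuncons n : measurable_fun [set: n.+1.-tuple T] (@tuncons n).
Proof.
by apply/measurable_fun_pair; [exact: measurable_tnth|exact: measurable_behead].
Qed.

Section cons_measure.
Variables (mu : {sigma_finite_measure set T -> \bar R}) (n : nat)
  (nu : {sigma_finite_measure set (n.-tuple T) -> \bar R}).

Definition cons_measure : set (n.+1.-tuple T) -> \bar R :=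
  pushforward (mu \x nu) (@tcons n).

Let cons_measure0 : cons_measure set0 = 0.
Proof. by rewrite /cons_measure /pushforward preimage_set0 measure0. Qed.

Let cons_measure_ge0 A : 0 <= cons_measure A.
Proof. exact: (@measure_ge0 _ _ _ (mu \x nu)). Qed.

Let cons_measure_sigma_additive : semi_sigma_additive cons_measure.
Proof.
move=> F mF tF mUF; rewrite /cons_measure /pushforward preimage_bigcup.
apply: (@measure_semi_sigma_additive _ _ _ (mu \x nu)).
- by move=> i; rewrite -[X in measurable X]setTI; exact: measurable_tcons.
- apply/trivIsetP => i j _ _ ij; rewrite -preimage_setI.
  by move/trivIsetP : tF => /(_ _ _ _ _ ij) ->//; rewrite preimage_set0.
- by rewrite -preimage_bigcup -[X in measurable X]setTI; exact: measurable_tcons.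
Qed.

HB.instance Definition _ := isMeasure.Build _ _ _ cons_measure
  cons_measure0 cons_measure_ge0 cons_measure_sigma_additive.

Let cons_measure_sigma_finite : sigma_finite setT cons_measure.
Proof.
have [F FT Foo] := product_sigma_finite mu nu.
exists (fun i => @tuncons n @^-1` F i).
  by rewrite -preimage_bigcup -FT preimage_setT.
move=> i; have [mF Fi] := Foo i; split.
  by rewrite -[X in measurable X]setTI; exact: measurable_tuncons.
rewrite /cons_measure /pushforward -comp_preimage.
by rewrite (_ : _ \o _ = id) ?preimage_id//; apply/funext => p /=; rewrite tconsK.
Qed.

HB.instance Definition _ := Measure_isSigmaFinite.Build _ _ _ cons_measure
  cons_measure_sigma_finite.

End cons_measure.

Fixpoint power_measure (mu : {sigma_finite_measure set T -> \bar R}) n :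
    {sigma_finite_measure set (n.-tuple T) -> \bar R} :=
  match n with
  | 0 => dirac [tuple]
  | n'.+1 => cons_measure mu (power_measure mu n')
  end.

End power_measure.

Local Notation plane R := (measurableTypeR R * measurableTypeR R)%type.

(* Lebesgue measure on R x R, i.e. on C through (a, b) |-> a + ib; a name of its
   own is needed for the sigma-finite structure to be inferred. *)
Definition lebesgue_measure2 (R : realType) : set (plane R) -> \bar R :=
  (@lebesgue_measure R \x @lebesgue_measure R)%E.
HB.instance Definition _ (R : realType) := Measure.on (@lebesgue_measure2 R).
HB.instance Definition _ (R : realType) :=
  Measure_isSigmaFinite.Build _ _ _ (@lebesgue_measure2 R)
    (product_sigma_finite (@lebesgue_measure R) (@lebesgue_measure R)).

HB.instance Definition _ (R : realType) := isPointed.Build R[i] 0.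

Section complex_vectors.
Context (R : realType) (n : nat).

Definition cvec (t : n.-tuple (plane R)) : 'cV[R[i]]_n :=
  \col_i ((tnth t i).1 +i* (tnth t i).2).

(* The Borel sigma-algebra of C^n = R^2n, transported along the bijection cvec. *)
Definition cvec_measurable : set (set 'cV[R[i]]_n) :=
  [set A | measurable (cvec @^-1` A)].

Let cvec_measurable0 : cvec_measurable set0.
Proof. by rewrite /cvec_measurable/= preimage_set0; exact: measurable0. Qed.

Let cvec_measurableC A : cvec_measurable A -> cvec_measurable (~` A).
Proof. by rewrite /cvec_measurable/= preimage_setC; exact: measurableC. Qed.

Let cvec_measurable_bigcup (F : (set 'cV[R[i]]_n)^nat) :
  (forall k, cvec_measurable (F k)) -> cvec_measurable (\bigcup_k F k).
Proof.
move=> mF; rewrite /cvec_measurable/= preimage_bigcup.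
by apply: bigcup_measurable => k _; exact: mF.
Qed.

HB.instance Definition _ := @isMeasurable.Build default_measure_display
  'cV[R[i]]_n cvec_measurable cvec_measurable0 cvec_measurableC
  cvec_measurable_bigcup.

Definition lebesgue_cvec : set 'cV[R[i]]_n -> \bar R :=
  pushforward (power_measure (@lebesgue_measure2 R) n) cvec.

Let lebesgue_cvec0 : lebesgue_cvec set0 = 0%E.
Proof. by rewrite /lebesgue_cvec /pushforward preimage_set0 measure0. Qed.

Let lebesgue_cvec_ge0 A : (0 <= lebesgue_cvec A)%E.
Proof. exact: (measure_ge0 (power_measure (@lebesgue_measure2 R) n)). Qed.

Let lebesgue_cvec_sigma_additive : semi_sigma_additive lebesgue_cvec.
Proof.
move=> F mF tF mUF; rewrite /lebesgue_cvec /pushforward preimage_bigcup.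
apply: (measure_semi_sigma_additive
  (s := power_measure (@lebesgue_measure2 R) n)).
- exact: mF.
- apply/trivIsetP => i j _ _ ij; rewrite -preimage_setI.
  by move/trivIsetP : tF => /(_ _ _ _ _ ij) ->//; rewrite preimage_set0.
- by rewrite -preimage_bigcup; exact: mUF.
Qed.

HB.instance Definition _ := isMeasure.Build _ _ _ lebesgue_cvec
  lebesgue_cvec0 lebesgue_cvec_ge0 lebesgue_cvec_sigma_additive.

End complex_vectors.

Section laws.
Context d (Omega : measurableType d) (R : realType) (P : probability Omega R).

(* Density of CN(0, Sigma), for Sigma Hermitian positive definite. *)
Definition cgauss_pdf n (Sigma : 'M[R[i]]_n) (x : 'cV[R[i]]_n) : R :=
  expR (- complex.Re ((x^t* *m invmx Sigma *m x) 0 0)) /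
  (pi ^+ n * complex.Re (\det Sigma)).

Definition cgauss_law n (X : {RV P >-> 'cV[R[i]]_n}) (Sigma : 'M[R[i]]_n) :=
  forall A : set 'cV[R[i]]_n, measurable A ->
    distribution P X A = (\int[@lebesgue_cvec R n]_(x in A)
                            (cgauss_pdf Sigma x)%:E)%E.

Definition independent_RV d1 d2 (T1 : measurableType d1)
    (T2 : measurableType d2) (X : {RV P >-> T1}) (Y : {RV P >-> T2}) :=
  forall (A : set T1) (B : set T2), measurable A -> measurable B ->
    P (X @^-1` A `&` Y @^-1` B) = (P (X @^-1` A) * P (Y @^-1` B))%E.

End laws.

Section punctured_augmented.
Context (R : realType).
Local Notation C := R[i].

Definition augmented M N (Es N0 : R) (H : 'M[C]_(M, N)) : 'M[C]_(M + N, N) :=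
  col_mx ((Num.sqrt N0)^-1%:C *: H) ((Num.sqrt Es)^-1%:C)%:M.

(* The order of R[i] is partial: 0 < z means that z is real and positive. *)
Definition thin_QL m n (A Q : 'M[C]_(m, n)) (L : 'M[C]_n) :=
  [/\ A = Q *m L, Q^t* *m Q = 1%:M, is_trig_mx L & forall i, 0 < L i i].

(* diag(A)^(-1/2) *)
Definition diag_inv_sqrt n (A : 'M[C]_n) : 'M[C]_n :=
  diag_mx (\row_i (sqrtC (A i i))^-1).

(* With N = nu + k, the blocks P_a, R_a, S_a of La are ulsubmx La, dlsubmx La and
   drsubmx La. *)
Context (nu k : nat).

Definition Omega_a (La : 'M[C]_(nu + k)) : 'M[C]_k :=
  let Sa := drsubmx La in diag_inv_sqrt (invmx Sa *m (invmx Sa)^t*).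

Definition W_ap (La : 'M[C]_(nu + k)) : 'M[C]_(nu + k) :=
  block_mx 1%:M 0 0 (Omega_a La *m invmx (drsubmx La)).

Definition L_ap (La : 'M[C]_(nu + k)) : 'M[C]_(nu + k) := W_ap La *m La.

End punctured_augmented.

Section awld.
Context (R : realType) (M N : nat).
Local Notation C := R[i].

Definition mmse_mx (alpha : R) (H : 'M[C]_(M, N)) : 'M[C]_(N, M) :=
  H^t* *m invmx (H *m H^t* + (alpha%:C)%:M).

Definition sqnorm n (x : 'cV[C]_n) : R := complex.Re ((x^t* *m x) 0 0).

(* The log-likelihood 2 Re(y^t* F x) - x^t* G x + x^t* x / Es; for Hermitian G
   the number x^t* G x is real, and Re only casts it from R[i] to R. *)
Definition awld_cond (Es : R) (F : 'M[C]_(M, N)) (G : 'M[C]_N)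
    (y : 'cV[C]_M) (x : 'cV[C]_N) : R :=
  expR (2 * complex.Re ((y^t* *m F *m x) 0 0)
        - complex.Re ((x^t* *m G *m x) 0 0) + Es^-1 * sqnorm x).

Definition input_pdf (Es : R) (x : 'cV[C]_N) : R :=
  (pi ^+ N * Es ^+ N)^-1 * expR (- (sqnorm x / Es)).

Definition awld_marg (Es : R) (F : 'M[C]_(M, N)) (G : 'M[C]_N)
    (y : 'cV[C]_M) : \bar R :=
  (\int[@lebesgue_cvec R N]_x (awld_cond Es F G y x * input_pdf Es x)%:E)%E.

(* Valued in \bar R, so that an equation with a real number entails that both
   expectations are finite. *)
Definition info_lower_bound d (Omega : measurableType d)
    (P : probability Omega R) (X : Omega -> 'cV[C]_N) (Y : Omega -> 'cV[C]_M)
    (pcond : 'cV[C]_M -> 'cV[C]_N -> R) (pmarg : 'cV[C]_M -> \bar R) : \bar R :=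
  ('E_P[fun w => ln (pcond (Y w) (X w))] - \int[P]_w lne (pmarg (Y w)))%E.

End awld.

(* Main.v *)
Require Import Defs.
From HB Require Import structures.
From mathcomp Require Import all_boot all_order all_algebra.
From mathcomp Require Import complex.
From mathcomp Require Import all_classical all_reals all_analysis.
From mathcomp Require Import measurable_realfun ring lra.

(* Write [m := M y] for the MMSE estimate of [x], so that [y^* F x = m^* G x]
   with [G = L^* L], [L = L_ap]. Completing the square,
     ln p(y|x) = |L m|^2 - |L (x - m)|^2 + |x|^2 / Es,
   and a Gaussian integral gives [ln p(y) = |L m|^2 - N ln Es - ln det G]. Hence
   the bound is [N ln Es + ln det G] plus [E|x|^2 / Es - E|L (x - m)|^2]. The
   first expectation is [N]. The MMSE error [x - m] has covariance
   [(H^* H / N0 + I / Es)^-1 = (La^* La)^-1], and [L = W La], so the second one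
   is [tr (W W^* )], which is [N] because [Omega_a] normalises the rows of
   [Sa^-1].

   As [L] is lower triangular with positive diagonal, the Gaussian integral is
   computed one coordinate at a time, without a linear change of variables. *)

Set Implicit Arguments.
Unset Strict Implicit.
Unset Printing Implicit Defensive.

Import Order.TTheory GRing.Theory Num.Theory.
Import numFieldNormedType.Exports.

Local Open Scope classical_set_scope.
Local Open Scope ring_scope.
Local Open Scope complex_scope.
Local Open Scope sesquilinear_scope.

Local Notation plane R := (measurableTypeR R * measurableTypeR R)%type.

(** * Integration against a density *)

Section density.
Context d (T : measurableType d) (R : realType).
Variables (mu nu : {measure set T -> \bar R}) (p : T -> R).
Hypotheses (p0 : forall x, 0 <= p x) (mp : measurable_fun setT p).
Hypothesis nuE : forall A, measurable A ->
  nu A = (\int[mu]_(x in A) (p x)%:E)%E.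
Local Open Scope ereal_scope.

Import HBNNSimple.

(** Monotone convergence along simple approximations of [f], on both sides, reduces this to
    indicators, where it is [nuE]. It turns moments under a law into Lebesgue integrals against
    [normal_pdf]. *)
Lemma ge0_integral_density (f : T -> \bar R) : measurable_fun setT f ->
  (forall x, 0 <= f x) -> \int[nu]_x f x = \int[mu]_x (f x * (p x)%:E).
Proof.
move=> mf f0; pose h := nnsfun_approx measurableT mf.
have mpE : measurable_fun setT (fun x => (p x)%:E) by exact/measurable_EFinP.
transitivity (lim (\int[nu]_x (h n x)%:E @[n --> \oo])).
  rewrite -monotone_convergence//=.
  - apply: eq_integral => ? /[!inE] xD; apply/esym/cvg_lim => //=.
    exact: cvg_nnsfun_approx.
  - by move=> n; exact/measurable_EFinP/measurable_funTS.
  - by move=> n ? _; rewrite lee_fin.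
  - by move=> ? _ ? ? mn; rewrite lee_fin; exact/lefP/nd_nnsfun_approx.
transitivity (lim (\int[mu]_x ((h n x)%:E * (p x)%:E) @[n --> \oo])); last first.
  rewrite -monotone_convergence//=.
  - apply: eq_integral => x _; apply/cvg_lim => //=.
    by apply: cvgeZr => //; exact: cvg_nnsfun_approx.
  - by move=> n; apply: emeasurable_funM => //; exact/measurable_EFinP.
  - by move=> n x _; rewrite -EFinM lee_fin mulr_ge0.
  - move=> x _ a b ab; rewrite -!EFinM lee_fin ler_wpM2r//.
    exact/lefP/nd_nnsfun_approx.
suff suf n : \int[nu]_x (h n x)%:E = \int[mu]_x ((h n x)%:E * (p x)%:E).
  by under eq_fun do rewrite suf.
under [LHS]eq_integral do rewrite fimfunE -fsumEFin//.
rewrite [LHS]ge0_integral_fsum//; last 2 first.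
  - by move=> r; exact/measurable_EFinP/measurableT_comp.
  - by move=> k x _; rewrite EFinM nnfun_muleindic_ge0.
under [RHS]eq_integral.
  move=> x xD; rewrite fimfunE -fsumEFin// ge0_mule_fsuml; last first.
    by move=> r; rewrite EFinM nnfun_muleindic_ge0.
  over.
rewrite [RHS]ge0_integral_fsum//; last 2 first.
  - move=> r; apply: emeasurable_funM => //; apply/measurable_EFinP.
    exact: measurableT_comp.
  - move=> k x _; apply: mule_ge0; last by rewrite lee_fin.
    by rewrite EFinM nnfun_muleindic_ge0.
apply: eq_fsbigr => r _.
have mhr : measurable (h n @^-1` [set r]) by [].
rewrite integralZl_indic_nnsfun// integral_indic// setIT nuE//.
(* A simple function [h n] is nonnegative, so a negative [r] has empty preimage and both terms
   vanish. *)
have [r0|r0] := leP 0%R r; last first.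
  rewrite preimage_nnfun0// integral_set0 mule0.
  by rewrite integral0_eq// => x _; rewrite indic0 mulr0 mul0e.
rewrite integral_mkcond -ge0_integralZl//; last 2 first.
  by apply/(measurable_restrictT _ _).1 => //; exact/measurable_funTS.
  by move=> x _; rewrite patchE; case: ifP => // _; rewrite lee_fin.
apply: eq_integral => x _; rewrite patchE EFinM -muleA indicE.
by case: ifP => _; rewrite ?mul1e// mul0e mule0.
Qed.

End density.

(** * Gaussian integrals over complex vectors *)

Section power_measure_integral.
Context d (T : measurableType d) (R : realType).
Variable mu : {sigma_finite_measure set T -> \bar R}.
Local Open Scope ereal_scope.

(** Tonelli through the pushforward by [tcons]; it drives every induction on the number of
    coordinates. *)
Lemma ge0_integral_power_cons n (f : n.+1.-tuple T -> \bar R) :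
  measurable_fun setT f -> (forall t, 0 <= f t) ->
  \int[power_measure mu n.+1]_t f t =
  \int[mu]_x \int[power_measure mu n]_t f (tcons (x, t)).
Proof.
move=> mf f0 /=; rewrite ge0_integral_pushforward//; last exact: measurable_tcons.
rewrite preimage_setT fubini_tonelli1//.
- by apply: measurableT_comp => //; exact: measurable_tcons.
- by move=> x; exact: f0.
Qed.

Lemma integral_power_prod n (f : 'I_n -> T -> R) (v : 'I_n -> R) :
  (forall i, measurable_fun setT (f i)) -> (forall i x, 0 <= f i x)%R ->
  (forall i, \int[mu]_x (f i x)%:E = (v i)%:E) ->
  \int[power_measure mu n]_t (\prod_(i < n) f i (tnth t i))%:E =
  (\prod_(i < n) v i)%:E.
Proof.
elim: n f v => [|n IH] f v mf f0 fv.
  under eq_integral do rewrite big_ord0.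
  by rewrite integral_dirac//= diracT mul1e big_ord0.
rewrite ge0_integral_power_cons; last 2 first.
- apply/measurable_EFinP.
  rewrite (_ : (fun t => _) = (fun t : n.+1.-tuple T =>
      \prod_(i <- index_enum 'I_n.+1) f i (tnth t i))%R)//.
  apply: measurable_prod => i _.
  by apply: (measurableT_comp (mf i)); exact: measurable_tnth.
- by move=> t; rewrite lee_fin prodr_ge0.
under eq_integral => x _.
  under eq_integral => t _.
    rewrite big_ord_recl/= EFinM (tnth_nth x)/=.
    under eq_bigr do rewrite (tnth_nth x)/= -tnth_nth.
    over.
  rewrite ge0_integralZl//; last 3 first.
  - apply/measurable_EFinP.
    apply: measurable_prod => i _.
    by apply: measurableT_comp => //; exact: measurable_tnth.
  - by move=> t _; rewrite lee_fin prodr_ge0.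
  - by rewrite lee_fin.
  rewrite (IH (fun i => f (lift ord0 i)) (fun i => v (lift ord0 i)))//.
  over.
rewrite /= ge0_integralZr//; last 3 first.
- exact/measurable_EFinP.
- by move=> x _; rewrite lee_fin.
- rewrite lee_fin prodr_ge0// => i _.
  by rewrite -lee_fin -fv integral_ge0// => x _; rewrite lee_fin.
by rewrite fv big_ord_recl EFinM.
Qed.

End power_measure_integral.

Section plane_integral.
Context (R : realType).
Local Open Scope ereal_scope.
Local Notation mu := (@lebesgue_measure R).

Lemma integral_plane_prod (g h : measurableTypeR R -> R) (a b : R) :
  measurable_fun setT g -> measurable_fun setT h ->
  (forall x, 0 <= g x)%R -> (forall x, 0 <= h x)%R ->
  \int[mu]_x (g x)%:E = a%:E -> \int[mu]_x (h x)%:E = b%:E ->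
  \int[@lebesgue_measure2 R]_z (g z.1 * h z.2)%:E = (a * b)%:E.
Proof.
move=> mg mh g0 h0 ga hb; rewrite fubini_tonelli1; last 2 first.
- apply/measurable_EFinP/measurable_funM; apply: measurableT_comp => //.
- by move=> z; rewrite lee_fin mulr_ge0.
under eq_integral => x _.
  rewrite /fubini_F; under eq_integral do rewrite EFinM/=.
  rewrite ge0_integralZl//= ?hb; last 3 first.
  - exact/measurable_EFinP.
  - by move=> y _; rewrite lee_fin.
  - by rewrite lee_fin.
  over.
rewrite /= ge0_integralZr ?ga//.
- exact/measurable_EFinP.
- by move=> y _; rewrite lee_fin.
- by rewrite -hb integral_ge0// => y _; rewrite lee_fin.
Qed.

(** The integrand is [Num.sqrt pi / l] times the normal density of mean [c / l] and variance
    [1 / (2 l^2)], which has total mass 1. *)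
Lemma integral_gauss_affine (l c : R) : (0 < l)%R ->
  \int[mu]_x (expR (- (l * x - c) ^+ 2))%:E = (Num.sqrt pi / l)%:E.
Proof.
(* This standard deviation makes [2 s^2 = 1 / l^2], so the exponents agree. *)
move=> l0; pose s := (l * Num.sqrt 2)^-1%R.
have s0 : s != 0%R by rewrite invr_neq0// gt_eqF// mulr_gt0// sqrtr_gt0.
have sE : (s ^+ 2 *+ 2 = l^-1 ^+ 2)%R.
  rewrite /s exprVn exprMn sqr_sqrtr// invfM exprVn -mulrnAr.
  by rewrite -[(2^-1 *+ 2)%R]mulr_natr mulVf// mulr1.
have pE : normal_peak s = (l / Num.sqrt pi)%R.
  rewrite /normal_peak -mulrnAl sE sqrtrM ?sqr_ge0// sqrtr_sqr.
  by rewrite ger0_norm ?invr_ge0 ?(ltW l0)// invfM invrK.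
have sp0 : (0 < Num.sqrt pi :> R)%R by rewrite sqrtr_gt0 pi_gt0.
transitivity (\int[mu]_x ((Num.sqrt pi / l)%:E * (normal_pdf (c / l) s x)%:E)).
  apply: eq_integral => x _; rewrite normal_pdfE// -EFinM pE mulrA.
  have -> : (Num.sqrt pi / l * (l / Num.sqrt pi) = 1)%R.
    by field; rewrite (gt_eqF l0) (gt_eqF sp0).
  rewrite mul1r /normal_fun sE; congr (expR _)%:E.
  by field; rewrite (gt_eqF l0).
rewrite ge0_integralZl//.
- by rewrite integral_normal_pdf mule1.
- by apply/measurable_EFinP; exact: measurable_normal_pdf.
- by move=> x _; rewrite lee_fin normal_pdf_ge0.
- by rewrite lee_fin divr_ge0// ltW.
Qed.

End plane_integral.

(** * Real and imaginary coordinates of complex vectors *)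

Section complex_coordinates.
Context (R : realType).
Local Notation C := R[i].

Lemma cReD (z w : C) : complex.Re (z + w) = complex.Re z + complex.Re w.
Proof. by case: z w => [a b] [c d]. Qed.

Lemma cImD (z w : C) : complex.Im (z + w) = complex.Im z + complex.Im w.
Proof. by case: z w => [a b] [c d]. Qed.

Lemma cReM (z w : C) : complex.Re (z * w) =
  complex.Re z * complex.Re w - complex.Im z * complex.Im w.
Proof. by case: z w => [a b] [c d]. Qed.

Lemma cImM (z w : C) : complex.Im (z * w) =
  complex.Re z * complex.Im w + complex.Im z * complex.Re w.
Proof. by case: z w => [a b] [c d]. Qed.

Lemma cRe_sum I (s : seq I) (F : I -> C) :
  complex.Re (\sum_(i <- s) F i) = \sum_(i <- s) complex.Re (F i).
Proof. by apply: (big_morph _ cReD). Qed.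

Lemma cIm_sum I (s : seq I) (F : I -> C) :
  complex.Im (\sum_(i <- s) F i) = \sum_(i <- s) complex.Im (F i).
Proof. by apply: (big_morph _ cImD). Qed.

Lemma gt0_complexE (z : C) : 0 < z ->
  0 < complex.Re z /\ z = (complex.Re z)%:C.
Proof. by case: z => a b; rewrite ltcE/= => /andP[/eqP-> ->]. Qed.

Lemma sqnormE n (x : 'cV[C]_n) : sqnorm x =
  \sum_i (complex.Re (x i 0) ^+ 2 + complex.Im (x i 0) ^+ 2).
Proof.
rewrite /sqnorm mxE cRe_sum; apply: eq_bigr => i _; rewrite !mxE.
by case: (x i 0) => a b /=; rewrite mulNr opprK !expr2.
Qed.

Lemma sqnorm_col_mx m n (u : 'cV[C]_m) (v : 'cV[C]_n) :
  sqnorm (col_mx u v) = sqnorm u + sqnorm v.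
Proof.
rewrite !sqnormE big_split_ord/=; congr (_ + _); apply: eq_bigr => i _.
  by rewrite col_mxEu.
by rewrite col_mxEd.
Qed.

Lemma measurable_cvec n : measurable_fun setT (@cvec R n).
Proof. by move=> _ A mA; rewrite setTI. Qed.

Lemma measurable_Re_cvec n (i : 'I_n) :
  measurable_fun setT (fun t : n.-tuple (plane R) => complex.Re (cvec t i 0)).
Proof.
under eq_fun do rewrite mxE/=.
by apply: measurableT_comp => //; exact: measurable_tnth.
Qed.

Lemma measurable_Im_cvec n (i : 'I_n) :
  measurable_fun setT (fun t : n.-tuple (plane R) => complex.Im (cvec t i 0)).
Proof.
under eq_fun do rewrite mxE/=.
by apply: measurableT_comp => //; exact: measurable_tnth.
Qed.

Lemma measurable_sqnorm_affine m n (A : 'M[C]_(m, n)) (c : 'cV[C]_m) :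
  measurable_fun setT (fun t : n.-tuple (plane R) => sqnorm (A *m cvec t - c)).
Proof.
under eq_fun do rewrite sqnormE.
apply: measurable_sum => i; apply: measurable_funD; apply: measurable_funX.
- under eq_fun do rewrite mxE cReD mxE cRe_sum.
  apply: measurable_funD => //; apply: measurable_sum => j.
  under eq_fun do rewrite cReM.
  by apply: measurable_funB; apply: measurable_funM => //;
    [exact: measurable_Re_cvec|exact: measurable_Im_cvec].
- under eq_fun do rewrite mxE cImD mxE cIm_sum.
  apply: measurable_funD => //; apply: measurable_sum => j.
  under eq_fun do rewrite cImM.
  by apply: measurable_funD; apply: measurable_funM => //;
    [exact: measurable_Im_cvec|exact: measurable_Re_cvec].
Qed.

(** Typing the column at [1 + n], convertible with [n.+1], makes block products available. *)
Lemma cvec_cons n (z : plane R) (t : n.-tuple (plane R)) :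
  cvec (tcons (z, t)) = col_mx (z.1 +i* z.2)%:M (cvec t) :> 'cV[C]_(1 + n).
Proof.
apply/colP => i; case: (split_ordP i) => j ->.
  by rewrite col_mxEu !mxE ord1 (tnth_nth z).
by rewrite col_mxEd !mxE !(tnth_nth z).
Qed.

End complex_coordinates.

Section gauss_integral_trig.
Context (R : realType).
Local Notation C := R[i].
Local Open Scope ereal_scope.

Lemma measurable_sqnorm_plane (l c : C) : measurable_fun setT
  (fun z : plane R => sqnorm ((l * (z.1 +i* z.2) - c)%:M : 'cV_1)).
Proof.
under eq_fun do rewrite sqnormE big_ord1 mxE eqxx mulr1n cReD cImD cReM cImM/=.
apply: measurable_funD; apply: measurable_funX; apply: measurable_funD => //.
  by apply: measurable_funB; exact: measurable_funM.
by apply: measurable_funD; exact: measurable_funM.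
Qed.

(** Since [l] is real, [|l z - c|^2] separates into one square in [Re z] and one in [Im z], so the
    integral is a product of two real Gaussian integrals. *)
Lemma integral_gauss_plane (l : C) (c : C) : (0 < l)%R ->
  \int[@lebesgue_measure2 R]_z
    (expR (- sqnorm ((l * (z.1 +i* z.2) - c)%:M : 'cV_1)))%:E =
  (pi / complex.Re l ^+ 2)%:E.
Proof.
move=> /gt0_complexE[l0 ->]; set r := complex.Re l in l0 *; case: c => a b.
transitivity (\int[@lebesgue_measure2 R]_z
  (expR (- (r * z.1 - a) ^+ 2) * expR (- (r * z.2 - b) ^+ 2))%:E).
  apply: eq_integral => -[x y] _ /=.
  have -> : (sqnorm ((r%:C * (x +i* y) - (a +i* b))%:M : 'cV_1) =
      (r * x - a) ^+ 2 + (r * y - b) ^+ 2)%R.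
    rewrite sqnormE big_ord1 mxE eqxx mulr1n /=.
    by congr (_ ^+ 2 + _ ^+ 2)%R; rewrite mul0r ?subr0 ?addr0.
  by rewrite opprD expRD.
have mg (c : R) : measurable_fun setT (fun x : R => expR (- (r * x - c) ^+ 2)).
  apply: measurableT_comp => //; apply: measurableT_comp => //.
  by apply: measurable_funX; apply: measurable_funB => //; exact: measurable_funM.
rewrite (@integral_plane_prod _ (fun x => expR (- (r * x - a) ^+ 2))
  (fun x => expR (- (r * x - b) ^+ 2)) (Num.sqrt pi / r) (Num.sqrt pi / r))//;
  try solve [exact: integral_gauss_affine|exact: mg].
by rewrite mulrACA -expr2 sqr_sqrtr ?pi_ge0// -invfM -expr2.
Qed.

(** Fixing the first coordinate only moves the centre of the remaining quadratic form, from [b] to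
    [b - r z]. *)
Lemma sqnorm_block_cons n (l c : C) (r b : 'cV[C]_n) (A : 'M[C]_n)
    (z : plane R) (t : n.-tuple (plane R)) :
  sqnorm (block_mx l%:M 0 r A *m cvec (tcons (z, t)) - col_mx c%:M b)%R =
  (sqnorm ((l * (z.1 +i* z.2) - c)%:M : 'cV_1) +
   sqnorm (A *m cvec t - (b - r *m (z.1 +i* z.2)%:M)))%R.
Proof.
rewrite cvec_cons mul_block_col mul0mx addr0 opp_col_mx add_col_mx.
rewrite sqnorm_col_mx -scalar_mxM -raddfB/=.
by rewrite opprB addrA [(A *m _ + _)%R]addrC.
Qed.

Lemma measurable_expR_sqnorm m n (A : 'M[C]_(m, n)) (c : 'cV[C]_m) :
  measurable_fun setT (fun t => (expR (- sqnorm (A *m cvec t - c)))%:E).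
Proof.
apply/measurable_EFinP; apply: measurableT_comp => //.
by apply: measurableT_comp => //; exact: measurable_sqnorm_affine.
Qed.

(** Induction on [n] with [c] arbitrary: the inner integral has a centre that depends on the first
    coordinate, but its value does not, so it factors out of the outer one. *)
Lemma integral_gauss_trig_tuple n (L : 'M[C]_n) (c : 'cV[C]_n) :
  is_trig_mx L -> (forall i, (0 < L i i)%R) ->
  \int[power_measure (@lebesgue_measure2 R) n]_t
    (expR (- sqnorm (L *m cvec t - c)))%:E =
  (pi ^+ n / (\prod_i complex.Re (L i i)) ^+ 2)%:E.
Proof.
elim: n L c => [|n IH] L c tL L0.
  rewrite integral_dirac//=; last exact: (measurable_expR_sqnorm L c).
  rewrite diracT mul1e sqnormE big_ord0 oppr0 expR0.
  by rewrite big_ord0 expr0 expr1n divr1.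
rewrite ge0_integral_power_cons//; last exact: (measurable_expR_sqnorm L c).
(* Retyped at [1 + n], [L] splits into blocks; triangularity makes the upper right one zero. *)
pose L' : 'M[C]_(1 + n) := L; pose c' : 'cV[C]_(1 + n) := c.
have L'E : L' = block_mx (L 0 0)%R%:M 0 (dlsubmx L') (drsubmx L').
  rewrite -[LHS]submxK; congr block_mx.
    by apply/matrixP => i j; rewrite !ord1 !mxE eqxx mulr1n !lshift0.
  apply/matrixP => i j; rewrite !mxE.
  by move/is_trig_mxP: tL; apply; rewrite ord1.
have c'E : c' = col_mx (c 0 0)%R%:M (dsubmx c').
  rewrite -[LHS]vsubmxK; congr col_mx.
  by apply/colP => i; rewrite !ord1 !mxE eqxx mulr1n !lshift0.
have sE z t : sqnorm (L *m cvec (tcons (z, t)) - c)%R =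
    (sqnorm ((L 0 0 * (z.1 +i* z.2) - c 0 0)%:M : 'cV_1) +
     sqnorm (drsubmx L' *m cvec t -
       (dsubmx c' - dlsubmx L' *m (z.1 +i* z.2)%:M)))%R.
  by rewrite -sqnorm_block_cons -L'E -c'E.
have tdr : is_trig_mx (drsubmx L').
  by apply/is_trig_mxP => i j ij; rewrite !mxE; move/is_trig_mxP: tL; apply.
have dr0 i : (0 < drsubmx L' i i)%R by rewrite !mxE.
under eq_integral => z _.
  under eq_integral => t _ do rewrite sE opprD expRD EFinM.
  rewrite ge0_integralZl//; last exact: (measurable_expR_sqnorm (drsubmx L')).
  rewrite IH//.
  over.
rewrite ge0_integralZr//; last 2 first.
- apply/measurable_EFinP; apply: measurableT_comp => //.
  by apply: measurableT_comp => //; exact: measurable_sqnorm_plane.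
- by rewrite lee_fin divr_ge0 ?sqr_ge0 ?exprn_ge0 ?pi_ge0.
rewrite integral_gauss_plane//.
rewrite -EFinM big_ord_recl [in RHS]exprS exprMn; congr EFin.
rewrite mulrACA -invfM; congr (_ * (_ * _ ^+ 2)^-1)%R.
by apply: eq_bigr => i _; rewrite !mxE; congr (complex.Re (L _ _)); apply/val_inj.
Qed.

End gauss_integral_trig.

(** * Second moments of Gaussian vectors *)

(** Dividing by [r - 1] gives [1 <= r (r + 1) q] for [r > 1] and the reverse for [r < 1]; letting
    [r] tend to 1 from either side forces [2 q = 1]. Explicit values of [r] replace the limits. *)
Lemma eq_half_of_scaling (R : realFieldType) (q : R) :
  (forall r, 0 < r -> r - 1 <= r * (r ^+ 2 - 1) * q) -> q = 2^-1.
Proof.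
move=> key; have [q1|q1|//] := ltgtP q 2^-1.
- have [q0|q0] := leP q 0; first by have := key 2 ltac:(lra); nra.
  (* With [q = (1 - 4 t) / 2], the product [(1 + t) (2 + t) q] stays below 1, against [key] at
     [r = 1 + t]. *)
  have [t tq] : exists t : R, (1 - 2 * q) / 4 = t by eexists.
  have t0 : 0 < t by lra.
  have qE : q = (1 - 4 * t) / 2 by lra.
  have := key (1 + t) ltac:(lra).
  have -> : 1 + t - 1 = t * 1 by ring.
  have -> : (1 + t) * ((1 + t) ^+ 2 - 1) * q = t * ((1 + t) * (2 + t) * q) by ring.
  by rewrite ler_pM2l// qE => h; exfalso; nra.
- have q00 : 0 < q by lra.
  (* Here [(1 - t) (2 - t) q = (2 q + 3) / 4 + t^2 q] exceeds 1, against [key] at [r = 1 - t]. *)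
  have [t tE] : exists t : R, (2 * q - 1) / (4 * q) = t by eexists.
  have tq : t * q = (2 * q - 1) / 4 by rewrite -tE; field; rewrite gt_eqF.
  have t0 : 0 < t by rewrite -tE divr_gt0//; lra.
  have t1 : t < 1 by rewrite -tE ltr_pdivrMr; lra.
  have := key (1 - t) ltac:(lra).
  have -> : 1 - t - 1 = t * (-1) by ring.
  have -> : (1 - t) * ((1 - t) ^+ 2 - 1) * q = t * (- ((1 - t) * (2 - t) * q)) by ring.
  rewrite ler_pM2l// => h; exfalso; have := mulr_gt0 t0 q00; nra.
Qed.

Section normal_moments.
Context (R : realType).
Local Notation mu := (@lebesgue_measure R).
Variables (s : R) (s0 : 0 < s).
Implicit Types r x : R.

(* [1 + t <= expR t] applied to the density ratio. *)
Lemma normal_pdf_rescale_ge r x : 0 < r ->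
  r * normal_pdf 0 s x - r * (r ^+ 2 - 1) / (2 * s ^+ 2) *
    (x ^+ 2 * normal_pdf 0 s x) <= normal_pdf 0 (s / r) x.
Proof.
move=> r0; have sn0 : s != 0 by rewrite gt_eqF.
have rn0 : r != 0 by rewrite gt_eqF.
have srn0 : s / r != 0 by rewrite mulf_neq0// invr_neq0.
rewrite !normal_pdfE//.
have -> : normal_peak (s / r) = r * normal_peak s.
  rewrite /normal_peak -!mulrnAr exprMn mulrAC sqrtrM; last first.
    by rewrite mulr_ge0 ?sqr_ge0// mulrn_wge0// pi_ge0.
  by rewrite sqrtr_sqr ger0_norm ?invr_ge0 ?(ltW r0)// invfM invrK mulrC.
have -> : normal_fun 0 (s / r) x =
    normal_fun 0 s x * expR (- (x ^+ 2 * (r ^+ 2 - 1) / (2 * s ^+ 2))).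
  rewrite /normal_fun -expRD; congr expR; rewrite !subr0.
  by field; rewrite sn0 rn0.
set p := normal_peak s; set g := normal_fun 0 s x.
set t := x ^+ 2 * (r ^+ 2 - 1) / (2 * s ^+ 2).
have gp : 0 <= r * p * g by rewrite !mulr_ge0 ?normal_peak_ge0 ?normal_fun_ge0 ?ltW.
apply: (@le_trans _ _ (r * p * g * (1 - t))).
  rewrite le_eqVlt; apply/orP; left; apply/eqP.
  by rewrite /t; field.
by rewrite [leRHS]mulrA ler_wpM2l// -[1 - t]/(1 + - t) expR_ge1Dx.
Qed.

Let pdf2 x := x ^+ 2 * normal_pdf 0 s x.

Let pdf2_ge0 x : 0 <= pdf2 x.
Proof. by rewrite mulr_ge0 ?sqr_ge0 ?normal_pdf_ge0. Qed.

Let measurable_pdf2 : measurable_fun setT pdf2.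
Proof.
apply: measurable_funM; last exact: measurable_normal_pdf.
exact: measurable_funX.
Qed.

(** At [r = 1/2] the coefficient of [x^2] in [normal_pdf_rescale_ge] turns positive, so [pdf2] is
    dominated by a multiple of the normal density of deviation [2 s]. *)
Let integrable_pdf2 : mu.-integrable setT (fun x => (pdf2 x)%:E).
Proof.
have : mu.-integrable setT
    (fun x => ((16 * s ^+ 2 / 3)%:E * (normal_pdf 0 (s / 2^-1) x)%:E)%E).
  by apply: integrableZl => //; exact: integrable_normal_pdf.
apply: le_integrable => //; first exact/measurable_EFinP.
move=> x _; rewrite -EFinM !abse_EFin lee_fin ger0_norm ?pdf2_ge0//.
have c0 : 0 <= 16 * s ^+ 2 / 3 by rewrite divr_ge0// mulr_ge0// sqr_ge0.
rewrite ger0_norm; last by rewrite mulr_ge0// normal_pdf_ge0.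
have := @normal_pdf_rescale_ge 2^-1 x ltac:(by rewrite invr_gt0).
rewrite -/(pdf2 x) => H.
have p0 := normal_pdf_ge0 0 s x.
have -> : pdf2 x = 16 * s ^+ 2 / 3 * (3 / (16 * s ^+ 2) * pdf2 x).
  by field; rewrite gt_eqF.
apply: ler_wpM2l => //.
apply: le_trans H.
have -> : 2^-1 * (2^-1 ^+ 2 - 1) / (2 * s ^+ 2) = - (3 / (16 * s ^+ 2)).
  by field; rewrite gt_eqF.
by rewrite mulNr opprK lerDr mulr_ge0.
Qed.

(** Integrating [normal_pdf_rescale_ge] bounds the second moment [E] for every [r > 0], with
    equality at [r = 1]. The tangency there determines [E], with no integration by parts. *)
Lemma integral_normal_sqr : (\int[mu]_x (x ^+ 2 * normal_pdf 0 s x)%:E)%E = (s ^+ 2)%:E.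
Proof.
rewrite -[LHS]/(\int[mu]_x (pdf2 x)%:E)%E.
have : (\int[mu]_x (pdf2 x)%:E)%E \is a fin_num by exact: integrable_fin_num.
have : (0 <= \int[mu]_x (pdf2 x)%:E)%E by apply: integral_ge0 => x _; rewrite lee_fin.
move HE : (\int[mu]_x (pdf2 x)%:E)%E => [E| |]//; rewrite lee_fin => E0 _.
have key r : 0 < r -> r - r * (r ^+ 2 - 1) / (2 * s ^+ 2) * E <= 1.
  move=> r0; rewrite -lee_fin -(integral_normal_pdf 0 (s / r)) EFinB EFinM.
  have ip := integrable_normal_pdf 0 s.
  rewrite -HE -integralZl// -[X in (X - _)%E]mule1 -(integral_normal_pdf 0 s).
  rewrite -integralZl// -integralB//; try exact: integrableZl.
  apply: le_integral => //; first by apply: integrableB => //; exact: integrableZl.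
    exact: integrable_normal_pdf.
  by move=> x _; rewrite -!EFinM -EFinB lee_fin; exact: normal_pdf_rescale_ge.
(* In this variable [key] no longer mentions [s], and the goal reads [q = 1/2]. *)
pose q := E / (2 * s ^+ 2).
have s20 : 0 < 2 * s ^+ 2 by rewrite mulr_gt0// exprn_gt0.
have Eq : E = q * (2 * s ^+ 2) by rewrite /q divfK// gt_eqF.
have {}key r : 0 < r -> r - 1 <= r * (r ^+ 2 - 1) * q.
  move=> /key; rewrite Eq [X in _ - X](_ : _ = r * (r ^+ 2 - 1) * q); first lra.
  by field; rewrite gt_eqF.
by rewrite Eq (eq_half_of_scaling key); congr EFin; field.
Qed.

(** The density is even and Lebesgue measure is invariant under negation. *)
Lemma normal_prob_opp (A : set (measurableTypeR R)) : measurable A ->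
  normal_prob 0 s (-%R @^-1` A) = normal_prob 0 s A.
Proof.
move=> mA; rewrite /normal_prob.
have mp : measurable_fun setT (fun x : measurableTypeR R => (normal_pdf 0 s x)%:E).
  by apply/measurable_EFinP; exact: measurable_normal_pdf.
have mN : measurable_fun setT (-%R : measurableTypeR R -> measurableTypeR R).
  exact: oppr_measurable.
transitivity (\int[pushforward mu (-%R : _ -> measurableTypeR R)]_(x in A)
    (normal_pdf 0 s x)%:E)%E; last first.
  by apply: eq_measure_integral => B mB _; exact: lebesgue_measureN.
rewrite (ge0_integral_pushforward mN mu mA); last 2 first.
  exact: measurable_funTS.
  by move=> x _; rewrite lee_fin normal_pdf_ge0.
apply: eq_integral => x _ /=.
by rewrite !normal_pdfE ?gt_eqF// /normal_fun !subr0 sqrrN.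
Qed.

End normal_moments.

Section adjoint.
Context (R : realType).
Local Notation C := R[i].

Lemma adjmxK m n (A : 'M[C]_(m, n)) : A^t*^t* = A.
Proof. by apply/matrixP => i j; rewrite !mxE conjCK. Qed.

Lemma adjmxD m n (A B : 'M[C]_(m, n)) : (A + B)^t* = A^t* + B^t*.
Proof. by rewrite linearD map_mxD. Qed.

Lemma adjmxN m n (A : 'M[C]_(m, n)) : (- A)^t* = - A^t*.
Proof. by rewrite linearN map_mxN. Qed.

Lemma adjmxM m n p (A : 'M[C]_(m, n)) (B : 'M[C]_(n, p)) :
  (A *m B)^t* = B^t* *m A^t*.
Proof. by rewrite trmx_mul map_mxM. Qed.

End adjoint.

(** * Finite means and correlation matrices *)

Section mean.
Context d (T : measurableType d) (R : realType) (P : probability T R).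
Local Notation C := R[i].
Implicit Types (f g : T -> R) (m : R).

(** Carrying integrability along with the value makes linearity free of side conditions, and shows
    at the end that the expectations are finite. *)
Definition has_mean f m :=
  P.-integrable setT (EFin \o f) /\ (\int[P]_w (f w)%:E = m%:E)%E.

Lemma has_mean_cst m : has_mean (fun=> m) m.
Proof.
split; first exact: finite_measure_integrable_cst.
by rewrite integral_cst//= probability_setT mule1.
Qed.

Lemma has_meanD f g m m' : has_mean f m -> has_mean g m' ->
  has_mean (fun w => f w + g w) (m + m').
Proof.
move=> [If fm] [Ig gm]; split.
  by apply: eq_integrable (integrableD measurableT If Ig) => // w _; rewrite /= EFinD.
by under eq_integral do rewrite EFinD; rewrite integralD// fm gm.
Qed.

Lemma has_meanZ c f m : has_mean f m -> has_mean (fun w => c * f w) (c * m).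
Proof.
move=> [If fm]; split.
  by apply: eq_integrable (integrableZl measurableT c If) => // w _; rewrite /= EFinM.
by under eq_integral do rewrite EFinM; rewrite integralZl// fm.
Qed.

Lemma has_meanN f m : has_mean f m -> has_mean (fun w => - f w) (- m).
Proof.
by move=> /(has_meanZ (-1)); rewrite mulN1r; under eq_fun do rewrite mulN1r.
Qed.

Definition has_cmean (f : T -> C) (m : C) :=
  has_mean (fun w => complex.Re (f w)) (complex.Re m) /\
  has_mean (fun w => complex.Im (f w)) (complex.Im m).

Lemma eq_has_cmean (f g : T -> C) (m : C) : f =1 g -> has_cmean f m -> has_cmean g m.
Proof. by move/funext => ->. Qed.

Lemma has_cmean0 : has_cmean (fun=> 0) 0.
Proof. by split; exact: has_mean_cst. Qed.

Lemma has_cmeanD (f g : T -> C) (m m' : C) : has_cmean f m -> has_cmean g m' ->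
  has_cmean (fun w => f w + g w) (m + m').
Proof.
move=> [fr fi] [gr gi]; rewrite /has_cmean cReD cImD.
under eq_fun do rewrite cReD; under [X in _ /\ has_mean X _]eq_fun do rewrite cImD.
by split; exact: has_meanD.
Qed.

Lemma has_cmeanZ c (f : T -> C) (m : C) : has_cmean f m ->
  has_cmean (fun w => c * f w) (c * m).
Proof.
move=> [fr fi]; rewrite /has_cmean cReM cImM.
under eq_fun do rewrite cReM; under [X in _ /\ has_mean X _]eq_fun do rewrite cImM.
split; last by apply: has_meanD; exact: has_meanZ.
by apply: has_meanD; [|apply: has_meanN]; exact: has_meanZ.
Qed.

Lemma has_cmean_conj (f : T -> C) (m : C) : has_cmean f m ->
  has_cmean (fun w => Num.conj (f w)) (Num.conj m).
Proof.
have Rc (z : C) : complex.Re (Num.conj z) = complex.Re z by case: z.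
have Ic (z : C) : complex.Im (Num.conj z) = - complex.Im z by case: z.
move=> [fr fi]; rewrite /has_cmean Rc Ic.
under eq_fun do rewrite Rc; under [X in _ /\ has_mean X _]eq_fun do rewrite Ic.
by split => //; exact: has_meanN.
Qed.

Lemma has_cmean_sum n (F : 'I_n -> T -> C) (m : 'I_n -> C) :
  (forall i, has_cmean (F i) (m i)) ->
  has_cmean (fun w => \sum_i F i w) (\sum_i m i).
Proof.
move=> Fm; elim: (index_enum _) => [|i s IH].
  by rewrite big_nil; under eq_fun do rewrite big_nil; exact: has_cmean0.
by rewrite big_cons; under eq_fun do rewrite big_cons; exact: has_cmeanD.
Qed.

Lemma has_cmean_mul_conj (f g : T -> C) (rr ii ir ri : R) :
  has_mean (fun w => complex.Re (f w) * complex.Re (g w)) rr ->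
  has_mean (fun w => complex.Im (f w) * complex.Im (g w)) ii ->
  has_mean (fun w => complex.Im (f w) * complex.Re (g w)) ir ->
  has_mean (fun w => complex.Re (f w) * complex.Im (g w)) ri ->
  has_cmean (fun w => f w * Num.conj (g w)) ((rr + ii) +i* (ir - ri)).
Proof.
move=> mrr mii mir mri; split => /=.
  have := has_meanD mrr mii; congr has_mean; apply/funext => w.
  by case: (f w) (g w) => a b [a' b'] /=; ring.
have := has_meanD mir (has_meanN mri); congr has_mean; apply/funext => w.
by case: (f w) (g w) => a b [a' b'] /=; ring.
Qed.

(** This is [E[u v^*] = K], uncentred. Its sesquilinearity reduces correlations of linear images to
    matrix algebra. *)
Definition has_cross p q (u : T -> 'cV[C]_p) (v : T -> 'cV[C]_q) (K : 'M[C]_(p, q)) :=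
  forall i j, has_cmean (fun w => u w i 0 * Num.conj (v w j 0)) (K i j).

Lemma has_crossC p q (u : T -> 'cV[C]_p) (v : T -> 'cV[C]_q) K :
  has_cross u v K -> has_cross v u (K^t*).
Proof.
move=> uv i j; rewrite !mxE; apply: eq_has_cmean (has_cmean_conj (uv j i)) => w.
by rewrite rmorphM/= conjCK mulrC.
Qed.

Lemma has_crossDl p q (u u' : T -> 'cV[C]_p) (v : T -> 'cV[C]_q) K K' :
  has_cross u v K -> has_cross u' v K' ->
  has_cross (fun w => u w + u' w) v (K + K').
Proof.
move=> uv uv' i j; rewrite mxE; apply: eq_has_cmean (has_cmeanD (uv i j) (uv' i j)) => w.
by rewrite mxE mulrDl.
Qed.

Lemma has_crossMl p p' q (A : 'M[C]_(p', p)) (u : T -> 'cV[C]_p)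
    (v : T -> 'cV[C]_q) K :
  has_cross u v K -> has_cross (fun w => A *m u w) v (A *m K).
Proof.
move=> uv i j; rewrite mxE.
apply: eq_has_cmean (has_cmean_sum (fun k => has_cmeanZ (A i k) (uv k j))) => w.
by rewrite mxE mulr_suml; apply: eq_bigr => k _; rewrite mulrA.
Qed.

Lemma has_crossDr p q (u : T -> 'cV[C]_p) (v v' : T -> 'cV[C]_q) K K' :
  has_cross u v K -> has_cross u v' K' ->
  has_cross u (fun w => v w + v' w) (K + K').
Proof.
move=> /has_crossC uv /has_crossC uv'.
have /has_crossC := has_crossDl uv uv'.
by rewrite adjmxD !adjmxK.
Qed.

Lemma has_crossMr p q q' (B : 'M[C]_(q', q)) (u : T -> 'cV[C]_p)
    (v : T -> 'cV[C]_q) K :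
  has_cross u v K -> has_cross u (fun w => B *m v w) (K *m B^t*).
Proof.
move=> /has_crossC uv; have /has_crossC := has_crossMl B uv.
by rewrite adjmxM adjmxK.
Qed.

Lemma has_cross_dot p (u v : T -> 'cV[C]_p) K :
  has_cross u v K -> has_cmean (fun w => ((v w)^t* *m u w) 0 0) (\tr K).
Proof.
move=> uv; apply: eq_has_cmean (has_cmean_sum (fun i => uv i i)) => w.
by rewrite mxE; apply: eq_bigr => i _; rewrite !mxE mulrC.
Qed.

End mean.

Section normal_variables.
Context d (T : measurableType d) (R : realType) (P : probability T R).

Lemma has_mean_normal_sqr (s : R) (U : T -> R) : 0 < s -> measurable_fun setT U ->
  (forall A : set (measurableTypeR R), measurable A ->
    P (U @^-1` A) = normal_prob 0 s A) ->
  has_mean P (fun w => U w ^+ 2) (s ^+ 2).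
Proof.
move=> s0 mU UE.
pose mixU := isMeasurableFun.Build _ _ _ (measurableTypeR R) _ mU.
pose X : {RV P >-> measurableTypeR R} := HB.pack U mixU.
have EU : (\int[P]_w (U w ^+ 2)%:E = (s ^+ 2)%:E)%E.
  transitivity (\int[distribution P X]_x (x ^+ 2)%:E)%E.
    rewrite ge0_integral_distribution//; last by move=> x; rewrite lee_fin sqr_ge0.
    by apply/measurable_EFinP; exact: measurable_funX.
  rewrite (@ge0_integral_density _ _ _ (@lebesgue_measure R) _ (normal_pdf 0 s)).
  - by under eq_integral do rewrite -EFinM; exact: integral_normal_sqr.
  - by move=> x; exact: normal_pdf_ge0.
  - exact: measurable_normal_pdf.
  - exact: UE.
  - by apply/measurable_EFinP; exact: measurable_funX.
  - by move=> x; rewrite lee_fin sqr_ge0.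
split => //; apply/integrableP; split.
  by apply/measurable_EFinP; exact: measurable_funX.
under eq_integral => w _ do rewrite /= ger0_norm ?sqr_ge0//.
by rewrite EU ltry.
Qed.

(* [(U, V)] and [(- U, V)] have the same law, so [E[UV] = - E[UV]]. *)
Lemma has_mean_normal_indep (s s' : R) (U V : T -> R) : 0 < s -> 0 < s' ->
  measurable_fun setT U -> measurable_fun setT V ->
  (forall A B : set (measurableTypeR R), measurable A -> measurable B ->
    P (U @^-1` A `&` V @^-1` B) = (normal_prob 0 s A * normal_prob 0 s' B)%E) ->
  has_mean P (fun w => U w * V w) 0.
Proof.
move=> s0 s'0 mU mV UV.
have UE (A : set (measurableTypeR R)) : measurable A -> P (U @^-1` A) = normal_prob 0 s A.
  move=> mA; rewrite -[U @^-1` A]setIT -(preimage_setT V) UV//.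
  by rewrite [X in (_ * X)%E]probability_setT mule1.
have VE (A : set (measurableTypeR R)) : measurable A -> P (V @^-1` A) = normal_prob 0 s' A.
  move=> mA; rewrite -[V @^-1` A]setTI -(preimage_setT U) UV//.
  by rewrite [X in (X * _)%E]probability_setT mul1e.
have [IU _] := has_mean_normal_sqr s0 mU UE.
have [IV _] := has_mean_normal_sqr s'0 mV VE.
have mUV : measurable_fun setT (fun w => U w * V w) by exact: measurable_funM.
(* Dominated by [U^2 + V^2], whose mean is finite. *)
have IUV : P.-integrable setT (EFin \o (fun w => U w * V w)).
  apply: le_integrable (integrableD measurableT IU IV) => //.
    exact/measurable_EFinP.
  move=> w _; rewrite /= lee_fin [leRHS]ger0_norm ?addr_ge0 ?sqr_ge0//.
  by rewrite ler_norml; apply/andP; split; nra.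
(* Rectangle probabilities determine a joint law, by uniqueness of the product measure; this applies
   to both [(U, V)] and [(- U, V)]. *)
have law (W : {RV P >-> plane R}) :
    (forall A B : set (measurableTypeR R), measurable A -> measurable B ->
      P (W @^-1` (A `*` B)) = (normal_prob 0 s A * normal_prob 0 s' B)%E) ->
    P.-integrable setT (EFin \o (fun w => (W w).1 * (W w).2)) ->
    (\int[P]_w ((W w).1 * (W w).2)%:E =
     \int[normal_prob 0 s \x normal_prob 0 s']_z (z.1 * z.2)%:E)%E.
  move=> WE IW.
  rewrite -[LHS](@integral_distribution _ _ _ _ _ P W (fun z => (z.1 * z.2)%:E))//.
    apply: eq_measure_integral => A mA _; apply/esym.
    exact: product_measure_unique.
  apply/measurable_EFinP; apply: measurable_funM; first exact: measurable_fst.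
  exact: measurable_snd.
have mW : measurable_fun setT (fun w => (U w, V w) : plane R).
  exact: measurable_fun_pair.
have mNU : measurable_fun setT (fun w => - U w : measurableTypeR R).
  exact: measurableT_comp.
have mW' : measurable_fun setT (fun w => (- U w, V w) : plane R).
  exact: measurable_fun_pair.
pose W : {RV P >-> plane R} := HB.pack (fun w => (U w, V w) : plane R)
  (isMeasurableFun.Build _ _ _ _ _ mW).
pose W' : {RV P >-> plane R} := HB.pack (fun w => (- U w, V w) : plane R)
  (isMeasurableFun.Build _ _ _ _ _ mW').
have WE := law W UV IUV.
have W'E : (\int[P]_w (- U w * V w)%:E =
     \int[normal_prob 0 s \x normal_prob 0 s']_z (z.1 * z.2)%:E)%E.
  apply: (law W') => [A B mA mB|].
    rewrite -[RHS](_ : (normal_prob 0 s (-%R @^-1` A) * normal_prob 0 s' B)%E = _).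
      have mNA : measurable ((-%R : measurableTypeR R -> _) @^-1` A).
        by have := @oppr_measurable R setT measurableT A mA; rewrite setTI.
      by rewrite -UV.
    by rewrite normal_prob_opp.
  apply: eq_integrable (integrableN IUV) => // w _.
  by rewrite /= mulNr EFinN.
split => //; move: W'E; rewrite -WE.
under eq_integral do rewrite mulNr EFinN.
rewrite integralN/=; last exact: integrable_add_def.
have : (\int[P]_w (U w * V w)%:E)%E \is a fin_num by exact: integrable_fin_num.
by case: (\int[P]_w _)%E => // r _ /= [] rE; congr EFin; lra.
Qed.

End normal_variables.

(** * Independence of the real coordinates of a complex Gaussian vector *)

Section gauss_law.
Context d (T : measurableType d) (R : realType) (P : probability T R).
Local Notation C := R[i].

(* The [2n] real coordinates of a complex vector, indexed by ['I_n * bool]. *)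
Definition rcoord n (p : 'I_n * bool) (v : 'cV[C]_n) : measurableTypeR R :=
  if p.2 then complex.Im (v p.1 0) else complex.Re (v p.1 0).

Lemma measurable_rcoord n (p : 'I_n * bool) : measurable_fun setT (@rcoord n p).
Proof.
move=> _ A mA; rewrite setTI /rcoord.
rewrite /measurable/= /cvec_measurable/= -[X in measurable X]setTI -comp_preimage.
case: p => i [] /=.
  exact: (measurable_Im_cvec i).
exact: (measurable_Re_cvec i).
Qed.

Lemma measurable_rcoord_box n (A : 'I_n * bool -> set (measurableTypeR R)) :
  (forall p, measurable (A p)) ->
  measurable [set v : 'cV[C]_n | forall p, A p (rcoord p v)].
Proof.
move=> mA; rewrite (_ : [set _ | _] = \bigcap_p (rcoord p @^-1` A p)).
  apply: fin_bigcap_measurable; first exact: finite_finset.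
  by move=> p _; rewrite -[X in measurable X]setTI; exact: measurable_rcoord.
by apply/seteqP; split => [v vA p _|v vA p]; exact: vA.
Qed.

Variables (n : nat) (c : R).
Hypothesis c0 : 0 < c.
Let s := Num.sqrt (c / 2).

Let s0 : 0 < s. Proof. by rewrite sqrtr_gt0 divr_gt0. Qed.

Let s2 : s ^+ 2 = c / 2. Proof. by rewrite sqr_sqrtr// divr_ge0// ltW. Qed.

(** Circular symmetry shares the variance [c] equally between real and imaginary parts, hence
    [s^2 = c / 2]. *)
Lemma cgauss_pdf_prod (v : 'cV[C]_n) : cgauss_pdf (c%:C)%:M v =
  \prod_(p : 'I_n * bool) normal_pdf 0 s (rcoord p v).
Proof.
have cn0 : c != 0 by rewrite gt_eqF.
have pi0 : pi != 0 :> R by rewrite gt_eqF// pi_gt0.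
have nE x : normal_pdf 0 s x = (Num.sqrt (pi * c))^-1 * expR (- (x ^+ 2 / c)).
  rewrite normal_pdfE ?gt_eqF// /normal_peak /normal_fun s2 subr0; congr (_^-1 * expR _).
    by congr Num.sqrt; rewrite -mulr_natr; field.
  by rewrite -mulr_natr; field.
transitivity (\prod_(i < n) \prod_(b : bool) normal_pdf 0 s (rcoord (i, b) v)); last first.
  by rewrite pair_big; apply: eq_bigr => -[i b].
under eq_bigr do rewrite big_bool !nE/=.
under eq_bigr do rewrite mulrACA -expRD -invfM -expr2 sqr_sqrtr ?mulr_ge0 ?pi_ge0 ?ltW//.
rewrite big_split/= prodr_const card_ord -expR_sum /cgauss_pdf mulrC; congr (_ * expR _).
  rewrite det_scalar exprVn exprMn; congr (_ * _)^-1.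
  by rewrite -rmorphXn.
rewrite invmx_scalar mul_mx_scalar -scalemxAl mxE -fmorphV cReM/= mul0r subr0.
rewrite -/(sqnorm v) sqnormE mulr_sumr -sumrN; apply: eq_bigr => i _.
by rewrite /rcoord/=; field.
Qed.

Variables (x : {RV P >-> 'cV[C]_n}).
Hypothesis hx : cgauss_law x (c%:C)%:M.

(** Density, reference measure and indicator of a box all factor over the coordinates, hence so does
    the probability: the real coordinates are independent normals. *)
Lemma cgauss_law_box (A : 'I_n * bool -> set (measurableTypeR R)) :
  (forall p, measurable (A p)) ->
  P (x @^-1` [set v | forall p, A p (rcoord p v)]) =
  (\prod_p fine (normal_prob 0 s (A p)))%:E.
Proof.
move=> mA.
have mB := measurable_rcoord_box mA.
rewrite -[LHS]/(distribution P x _) hx//.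
pose g (p : 'I_n * bool) (y : measurableTypeR R) := normal_pdf 0 s y * \1_(A p) y.
have g0 p y : 0 <= g p y by rewrite mulr_ge0// normal_pdf_ge0.
have mg p : measurable_fun setT (g p).
  apply: measurable_funM; first exact: measurable_normal_pdf.
  exact: measurable_indic.
have gE p : (\int[@lebesgue_measure R]_y (g p y)%:E =
    (fine (normal_prob 0 s (A p)))%:E)%E.
  rewrite fineK; last exact: fin_num_measure.
  rewrite /normal_prob [RHS]integral_mkcond.
  apply: eq_integral => y _.
  by rewrite /g patchE indicE; case: ifP; rewrite ?mulr1 ?mulr0.
pose h (i : 'I_n) (z : plane R) := g (i, false) z.1 * g (i, true) z.2.
have hE t : \prod_i h i (tnth t i) = \prod_p g p (rcoord p (cvec t)).
  transitivity (\prod_(i < n) \prod_(b : bool) g (i, b) (rcoord (i, b) (cvec t))).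
    by apply: eq_bigr => i _; rewrite big_bool/= mulrC /rcoord !mxE.
  by rewrite pair_big; apply: eq_bigr => -[].
transitivity (\int[power_measure (@lebesgue_measure2 R) n]_t
    (\prod_i h i (tnth t i))%:E)%E.
  rewrite [LHS]integral_mkcond ge0_integral_pushforward//.
  - rewrite preimage_setT; apply: eq_integral => t _ /=.
    rewrite patchE hE cgauss_pdf_prod; case: ifPn => [/set_mem/= tA|/negP tA].
      congr EFin; apply: eq_bigr => p _.
      by rewrite /g indicE mem_set ?mulr1//; exact: tA.
    (* Outside the box some coordinate leaves its set, and its indicator annihilates the product. *)
    have [p pA] : exists p, ~ A p (rcoord p (cvec t)).
      by apply/existsNP => ?; apply: tA; rewrite inE.
    rewrite (bigD1 p)//= {1}/g indicE memNset// mulr0 mul0r.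
    by [].
  - exact: measurable_cvec.
  - apply/(measurable_restrictT _ _).1 => //; apply: measurable_funTS.
    apply/measurable_EFinP; rewrite (funext cgauss_pdf_prod).
    apply: measurable_prod => p _; apply: measurableT_comp.
      exact: measurable_normal_pdf.
    exact: measurable_rcoord.
  - move=> v _; rewrite patchE; case: ifP => // _.
    by rewrite lee_fin cgauss_pdf_prod prodr_ge0// => p _; exact: normal_pdf_ge0.
rewrite (@integral_power_prod _ _ _ _ _ h
  (fun i => fine (normal_prob 0 s (A (i, false))) *
            fine (normal_prob 0 s (A (i, true))))).
- transitivity ((\prod_(i < n) \prod_(b : bool) fine (normal_prob 0 s (A (i, b))))%:E).
    by congr EFin; apply: eq_bigr => i _; rewrite big_bool/= mulrC.
  by rewrite pair_big; congr EFin; apply: eq_bigr => -[].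
- by move=> i; apply: measurable_funM; apply: measurableT_comp.
- by move=> i z; rewrite mulr_ge0.
- by move=> i; exact: integral_plane_prod.
Qed.

End gauss_law.

Section gauss_second_moments.
Context d (T : measurableType d) (R : realType) (P : probability T R).
Local Notation C := R[i].

Lemma measurable_rcoord_RV n (x : {RV P >-> 'cV[C]_n}) p :
  measurable_fun setT (fun w => rcoord p (x w)).
Proof. exact: (measurableT_comp (measurable_rcoord p)). Qed.

Section one_law.
Variables (n : nat) (c : R) (x : {RV P >-> 'cV[C]_n}).
Hypotheses (c0 : 0 < c) (hx : cgauss_law x (c%:C)%:M).
Let s := Num.sqrt (c / 2).

Lemma cgauss_law_rcoord2 p q (A B : set (measurableTypeR R)) : p != q ->
  measurable A -> measurable B ->
  P ((fun w => rcoord p (x w)) @^-1` A `&` (fun w => rcoord q (x w)) @^-1` B) =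
  (normal_prob 0 s A * normal_prob 0 s B)%E.
Proof.
move=> pq mA mB.
(* The event is a box whose other sides are the whole line, each contributing a factor 1. *)
pose F r := if r == p then A else if r == q then B else setT.
have mF r : measurable (F r) by rewrite /F; case: ifP => // _; case: ifP.
rewrite (_ : _ `&` _ = x @^-1` [set v | forall r, F r (rcoord r v)]); last first.
  apply/seteqP; split => w /=; last first.
    move=> wF; split; first by have := wF p; rewrite /F eqxx.
    by have := wF q; rewrite /F eq_sym (negbTE pq) eqxx.
  move=> [wA wB] r; rewrite /F; case: eqVneq => [->//|_].
  by case: eqVneq => [->|].
rewrite (cgauss_law_box c0 hx)// (bigD1 p)//= (bigD1 q) 1?eq_sym//=.
rewrite big1 ?mulr1 => [|r /andP[rp rq]]; last first.
  rewrite /F (negbTE rp) (negbTE rq).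
  by rewrite [normal_prob _ _ _]probability_setT.
rewrite /F eqxx [q == p]eq_sym (negbTE pq) eqxx EFinM !fineK//; exact: fin_num_measure.
Qed.

Lemma cgauss_law_rcoord p (A : set (measurableTypeR R)) : measurable A ->
  P ((fun w => rcoord p (x w)) @^-1` A) = normal_prob 0 s A.
Proof.
(* The other part of the same complex entry always supplies a second coordinate, left
   unconstrained. *)
move=> mA; have pq : p != (p.1, ~~ p.2) by case: p => i []; apply/eqP => -[].
have := cgauss_law_rcoord2 pq mA measurableT.
by rewrite preimage_setT setIT [X in (_ * X)%E]probability_setT mule1.
Qed.

Lemma has_mean_rcoord p q :
  has_mean P (fun w => rcoord p (x w) * rcoord q (x w)) (c / 2 *+ (p == q)).
Proof.
have s0 : 0 < s by rewrite sqrtr_gt0 divr_gt0.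
have [->|pq] := eqVneq q p.
  rewrite mulr1n -(sqr_sqrtr (_ : 0 <= c / 2)); last by rewrite divr_ge0// ltW.
  have := has_mean_normal_sqr s0 (measurable_rcoord_RV x p) (@cgauss_law_rcoord p).
  by under eq_fun do rewrite expr2.
apply: (has_mean_normal_indep s0 s0); try exact: measurable_rcoord_RV.
by move=> A B mA mB; apply: cgauss_law_rcoord2 => //; rewrite eq_sym.
Qed.

(** On the diagonal the two squares contribute [c / 2] each; products of distinct real coordinates
    have mean zero. *)
Lemma has_cross_cgauss : has_cross P x x (c%:C)%:M.
Proof.
move=> i j; rewrite mxE.
have H b b' := has_mean_rcoord (i, b) (j, b').
have := has_cmean_mul_conj (H false false) (H true true) (H true false) (H false true).
congr has_cmean; rewrite !xpair_eqE !andbT !andbF subrr.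
by case: (i == j); rewrite ?mulr1n ?mulr0n ?addr0// -splitr.
Qed.

End one_law.

Lemma has_cross_indep m n (a c : R) (x : {RV P >-> 'cV[C]_m})
    (z : {RV P >-> 'cV[C]_n}) : 0 < a -> 0 < c ->
  cgauss_law x (a%:C)%:M -> cgauss_law z (c%:C)%:M -> independent_RV x z ->
  has_cross P x z 0.
Proof.
move=> a0 c0 hx hz xz i j; rewrite mxE.
have H b b' : has_mean P (fun w => rcoord (i, b) (x w) * rcoord (j, b') (z w)) 0.
  have sa0 : 0 < Num.sqrt (a / 2) by rewrite sqrtr_gt0 divr_gt0.
  have sc0 : 0 < Num.sqrt (c / 2) by rewrite sqrtr_gt0 divr_gt0.
  apply: (has_mean_normal_indep sa0 sc0); try exact: measurable_rcoord_RV.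
  move=> A B mA mB.
  rewrite -(cgauss_law_rcoord a0 hx (i, b) mA) -(cgauss_law_rcoord c0 hz (j, b') mB).
  apply: (xz (rcoord (i, b) @^-1` A) (rcoord (j, b') @^-1` B)).
    by rewrite -[X in measurable X]setTI; exact: measurable_rcoord.
  by rewrite -[X in measurable X]setTI; exact: measurable_rcoord.
have := has_cmean_mul_conj (H false false) (H true true) (H true false) (H false true).
by rewrite addr0 subrr.
Qed.

End gauss_second_moments.

(** * The MMSE error and the punctured factor *)

Section positive_triangular.
Context (R : realType).
Local Notation C := R[i].
Variables (n : nat) (L : 'M[C]_n).
Hypotheses (tL : is_trig_mx L) (L0 : forall i, 0 < L i i).

Lemma unitmx_trig : L \in unitmx.
Proof.
rewrite unitmxE det_trig// unitfE; apply/prodf_neq0 => i _.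
by rewrite gt_eqF.
Qed.

Lemma det_gram_trig : complex.Re (\det (L^t* *m L)) = (\prod_i complex.Re (L i i)) ^+ 2.
Proof.
rewrite det_mulmx det_map_mx det_tr det_trig//.
have -> : \prod_i L i i = (\prod_i complex.Re (L i i))%:C.
  by rewrite rmorph_prod; apply: eq_bigr => i _; have [_ ] := gt0_complexE (L0 i).
by rewrite cReM /= oppr0 mul0r subr0 expr2.
Qed.

Lemma prod_diag_trig_gt0 : 0 < \prod_i complex.Re (L i i).
Proof. by apply: prodr_gt0 => i _; have [] := gt0_complexE (L0 i). Qed.

End positive_triangular.

Section inverse_identities.
Variable F : fieldType.

(** Used with [X = La] and [Y = La^*], to cancel [La] against the error covariance
    [(La^* La)^-1]. *)
Lemma mulmx_inv_mul m p n (A : 'M[F]_(m, n)) (B : 'M[F]_(n, p)) (X Y : 'M[F]_n) :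
  X \in unitmx -> Y \in unitmx -> A *m X *m invmx (Y *m X) *m (Y *m B) = A *m B.
Proof.
move=> uX uY; have uYX : Y *m X \in unitmx by rewrite unitmx_mul uY.
have -> : invmx (Y *m X) = invmx X *m invmx Y.
  apply: (can_inj (mulmxK uYX)).
  by rewrite mulVmx// !mulmxA mulmxKV// mulVmx.
by rewrite !mulmxA mulmxK// mulmxKV.
Qed.

(** The push-through rule, which trades the [M] by [M] inverse in [mmse_mx] for the [N] by [N]
    inverse of [J]. *)
Lemma invmx_intertwine m n (B : 'M[F]_(n, m)) (X : 'M[F]_m) (Y : 'M[F]_n) (a : F) :
  X \in unitmx -> Y \in unitmx -> a != 0 -> B *m X = a *: (Y *m B) ->
  B *m invmx X = a^-1 *: (invmx Y *m B).
Proof.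
move=> uX uY a0 BX; apply: (can_inj (mulmxK uX)).
by rewrite mulmxKV// -scalemxAl -mulmxA BX -scalemxAr scalerA mulVf// scale1r mulKmx.
Qed.

End inverse_identities.

Section real_scalars.
Context (R : realType).

Lemma conj_realC (r : R) : Num.conj (r%:C) = r%:C.
Proof. by rewrite /Num.conj/= oppr0. Qed.

Lemma adjmxZ m n (r : R) (A : 'M[R[i]]_(m, n)) : (r%:C *: A)^t* = r%:C *: A^t*.
Proof. by apply/matrixP => i j; rewrite !mxE rmorphM/= conj_realC. Qed.

Lemma adjmx_scalar n (r : R) : ((r%:C)%:M : 'M[R[i]]_n)^t* = (r%:C)%:M.
Proof.
by apply/matrixP => i j; rewrite !mxE eq_sym; case: eqP => _; rewrite ?conj_realC// conjC0.
Qed.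

Lemma adjmx_inv n (A : 'M[R[i]]_n) : (invmx A)^t* = invmx (A^t*).
Proof. by rewrite trmx_inv map_invmx. Qed.

End real_scalars.

Section mmse.
Context (R : realType) (M N : nat).
Local Notation C := R[i].
Variables (H : 'M[C]_(M, N)) (Es N0 : R) (J : 'M[C]_N).
Hypotheses (hEs : 0 < Es) (hN0 : 0 < N0) (uJ : J \in unitmx).
Hypothesis JE : J = N0^-1%:C *: (H^t* *m H) + (Es^-1%:C)%:M.

Let N0C : N0%:C != 0. Proof. by rewrite fmorph_eq0 gt_eqF. Qed.
Let EsC : Es%:C != 0. Proof. by rewrite fmorph_eq0 gt_eqF. Qed.
Let invC (r : R) : r^-1%:C = (r%:C)^-1. Proof. exact: fmorphV. Qed.

(** Both sides expand to [H^* H H^* + (N0 / Es) H^*]. *)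
Let JH : H^t* *m (H *m H^t* + ((N0 / Es)%:C)%:M) = N0%:C *: (J *m H^t*).
Proof.
rewrite JE mulmxDl scalerDr mulmxDr -scalemxAl scalerA invC mulfV// scale1r mulmxA.
by rewrite mul_scalar_mx mul_mx_scalar scalerA -rmorphM.
Qed.

Let HJ : (H *m H^t* + ((N0 / Es)%:C)%:M) *m H = N0%:C *: (H *m J).
Proof.
rewrite JE mulmxDr scalerDr mulmxDl -scalemxAr scalerA invC mulfV// scale1r mulmxA.
by rewrite mul_scalar_mx mul_mx_scalar scalerA -rmorphM.
Qed.

(* The inverse given by the Woodbury identity. *)
Lemma unitmx_mmse : H *m H^t* + ((N0 / Es)%:C)%:M \in unitmx.
Proof.
set A := _ + _; set a := (N0 / Es)%:C.
have a0 : a != 0 by rewrite fmorph_eq0 mulf_neq0 ?invr_neq0 ?gt_eqF.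
suff /mulmx1_unit[] : A *m (a^-1 *: (1%:M - N0^-1%:C *: (H *m invmx J *m H^t*))) = 1%:M.
  by [].
rewrite -scalemxAr mulmxBr mulmx1 -scalemxAr -!mulmxA [A *m (H *m _)]mulmxA HJ.
rewrite -scalemxAl scalerA invC mulVf// scale1r -!mulmxA [J *m _]mulmxA mulmxV// mul1mx.
by rewrite /A [X in X - _]addrC addrK scale_scalar_mx mulVf.
Qed.

Lemma mmse_mxE : mmse_mx (N0 / Es) H = N0^-1%:C *: (invmx J *m H^t*).
Proof.
by rewrite invC; exact: invmx_intertwine unitmx_mmse uJ N0C JH.
Qed.

(** The left side is the coefficient of [x] in the error; it equals [J^-1 (J - H^* H / N0)]. *)
Lemma mmse_error_signal : 1%:M - mmse_mx (N0 / Es) H *m H = Es^-1%:C *: invmx J.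
Proof.
rewrite mmse_mxE -scalemxAl -mulmxA.
have : invmx J *m J = 1%:M by rewrite mulVmx.
rewrite {2}JE mulmxDr mul_mx_scalar -scalemxAr => <-.
by rewrite addrC addKr.
Qed.

Let adjJ : J^t* = J.
Proof. by rewrite JE adjmxD adjmxZ adjmxM adjmxK adjmx_scalar. Qed.

(** With the error written [A x + B n], the sum is [J^-1 (I / Es + H^* H / N0) J^-1 = J^-1 J
    J^-1]. *)
Lemma mmse_error_cov (A : 'M[C]_N) (B : 'M[C]_(N, M)) :
  A = Es^-1%:C *: invmx J -> B = - mmse_mx (N0 / Es) H ->
  A *m (Es%:C)%:M *m A^t* + B *m (N0%:C)%:M *m B^t* = invmx J.
Proof.
move=> -> ->; rewrite mmse_mxE adjmxN !adjmxZ adjmxM adjmxK adjmx_inv adjJ.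
rewrite !mul_mx_scalar scalerN mulNmx mulmxN opprK.
have : invmx J *m J *m invmx J = invmx J by rewrite mulVmx// mul1mx.
move: (invmx J) => K; rewrite JE => KJK; rewrite -[RHS]KJK.
rewrite !scalerA !invC !mulfV// !scale1r.
rewrite mulmxDr mulmxDl addrC -!scalemxAr -!scalemxAl mul_mx_scalar -scalemxAl.
by rewrite !mulmxA.
Qed.

End mmse.

Section punctured.
Context (R : realType) (nu k : nat).
Local Notation C := R[i].
Variable La : 'M[C]_(nu + k).
Hypotheses (tL : is_trig_mx La) (L0 : forall i, 0 < La i i).
Let S := drsubmx La.

Let tS : is_trig_mx S.
Proof.
apply/is_trig_mxP => i j ij; rewrite !mxE; move/is_trig_mxP: tL; apply.
by rewrite /= ltn_add2l.
Qed.

Let S0 i : 0 < S i i. Proof. by rewrite !mxE. Qed.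

Let uS : S \in unitmx. Proof. exact: unitmx_trig. Qed.

Let A := invmx S *m (invmx S)^t*.

(** It is the squared norm of row [i] of [S^-1]; a zero row would contradict [S^-1 S = 1]. *)
Let A0 i : 0 < A i i.
Proof.
have Ai : A i i = \sum_j `|invmx S i j| ^+ 2.
  by rewrite mxE; apply: eq_bigr => j _; rewrite !mxE normCK.
rewrite lt_def Ai sumr_ge0 ?andbT => [|j _]; last by rewrite exprn_ge0.
apply/eqP => /psumr_eq0P H.
have /matrixP/(_ i i) : invmx S *m S = 1%:M by rewrite mulVmx.
rewrite !mxE eqxx big1 => [/esym/eqP|j _]; first by rewrite oner_eq0.
have /eqP := H (fun j _ => exprn_ge0 2 (normr_ge0 _)) j isT.
by rewrite sqrf_eq0 normr_eq0 => /eqP ->; rewrite mul0r.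
Qed.

Lemma L_apE : L_ap La = block_mx (ulsubmx La) 0
  (Omega_a La *m invmx S *m dlsubmx La) (Omega_a La).
Proof.
have urE : ursubmx La = 0.
  apply/matrixP => i j; rewrite !mxE; move/is_trig_mxP: tL; apply.
  by rewrite /= (leq_trans (ltn_ord i))// leq_addr.
rewrite /L_ap /W_ap -[X in block_mx _ _ _ _ *m X]submxK urE.
rewrite mulmx_block !mul1mx !mul0mx ?mulmx0 !addr0 !add0r.
by rewrite -/S mulmxKV.
Qed.

Lemma L_ap_trig : is_trig_mx (L_ap La).
Proof.
rewrite L_apE is_trig_block_mx// eqxx /=; apply/andP; split.
  by apply/is_trig_mxP => i j ij; rewrite !mxE; move/is_trig_mxP: tL; apply.
exact: diag_mx_is_trig.
Qed.

(** The first [nu] entries come from [La]; the others are inverse square roots of the positive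
    [A i i]. *)
Lemma L_ap_diag_gt0 i : 0 < L_ap La i i.
Proof.
rewrite L_apE; case: (split_ordP i) => j ->.
  by rewrite block_mxEul !mxE.
rewrite block_mxEdr !mxE eqxx mulr1n invr_gt0 sqrtC_gt0.
by have := A0 j; rewrite /A mxE.
Qed.

(* [Omega_a] normalises every row of [S^-1]. *)
Lemma trace_W_ap : \tr (W_ap La *m (W_ap La)^t*) = (nu + k)%:R.
Proof.
rewrite /W_ap tr_block_mx map_block_mx mulmx_block mxtrace_block.
rewrite !trmx1 !map_mx1 !trmx0 !map_mx0 !mulmx1 !mul0mx !addr0 !add0r mxtrace1 natrD.
congr (_ + _); rewrite adjmxM mulmxA -[X in X *m _]mulmxA -/S -/A /Omega_a -/S -/A.
rewrite /diag_inv_sqrt tr_diag_mx map_diag_mx mul_diag_mx mul_mx_diag /mxtrace.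
transitivity (\sum_(i < k) (1 : C)); last by rewrite sumr_const card_ord.
apply: eq_bigr => i _; have := A0 i; rewrite {1}/A mxE => a0; rewrite !mxE.
move: a0; set a := \sum_j _ => a0.
have r0 : 0 < sqrtC a by rewrite sqrtC_gt0.
rewrite /= geC0_conj ?invr_ge0 ?ltW// -[X in _ * X * _](sqrtCK a) expr2.
by rewrite mulKf ?gt_eqF// mulfV// gt_eqF.
Qed.

End punctured.

(** * The AWLD likelihood and its marginal *)

Section awld_model.
Context (R : realType) (M N : nat).
Local Notation C := R[i].

Lemma sqnormB n (u v : 'cV[C]_n) :
  sqnorm (u - v) = sqnorm u - 2 * complex.Re ((v^t* *m u) 0 0) + sqnorm v.
Proof.
rewrite !sqnormE mxE cRe_sum mulr_sumr -sumrB -big_split; apply: eq_bigr => i _.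
by rewrite !mxE; case: (u i 0) (v i 0) => a b [a' b'] /=; ring.
Qed.

(** Immediate from the sigma-algebra being transported along [cvec]. *)
Lemma measurable_cvecP d (T : measurableType d) n (f : 'cV[C]_n -> T) :
  measurable_fun setT (f \o @cvec R n) -> measurable_fun setT f.
Proof.
move=> mf _ B mB; rewrite setTI /measurable/= /cvec_measurable/=.
by rewrite -[X in measurable X]setTI -comp_preimage; exact: mf.
Qed.

Variables (Es : R) (A : 'M[C]_(N, M)) (L : 'M[C]_N).
Hypotheses (hEs : 0 < Es) (tL : is_trig_mx L) (L0 : forall i, 0 < L i i).
Let G := L^t* *m L.
Let F := A^t* *m G.

(** Completing the square around the linear estimate [A y]; [A] later becomes the MMSE matrix. *)
Lemma awld_condE (y : 'cV[C]_M) (x : 'cV[C]_N) : awld_cond Es F G y x =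
  expR (sqnorm (L *m (A *m y)) - sqnorm (L *m x - L *m (A *m y)) + Es^-1 * sqnorm x).
Proof.
have e1 : y^t* *m F *m x = (L *m (A *m y))^t* *m (L *m x).
  by rewrite /F /G !adjmxM !mulmxA.
have e2 : x^t* *m G *m x = (L *m x)^t* *m (L *m x).
  by rewrite /G adjmxM !mulmxA.
rewrite /awld_cond e1 e2 sqnormB -/(sqnorm (L *m x)); congr expR.
move: (sqnorm (L *m x)) (sqnorm (L *m (A *m y))) (sqnorm x) (complex.Re _).
by move=> a b q r; ring.
Qed.

Lemma awld_margE (y : 'cV[C]_M) : awld_marg Es F G y =
  (expR (sqnorm (L *m (A *m y))) /
   (Es ^+ N * (\prod_i complex.Re (L i i)) ^+ 2))%:E.
Proof.
set b := L *m (A *m y); set D := \prod_i _.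
have D0 : 0 < D := prod_diag_trig_gt0 L0.
pose c := expR (sqnorm b) / (pi ^+ N * Es ^+ N).
have c0 : 0 <= c.
  by rewrite divr_ge0 ?expR_ge0// mulr_ge0// exprn_ge0 ?pi_ge0// ltW.
have mE : measurable_fun setT (fun x : 'cV[C]_N => (expR (- sqnorm (L *m x - b)))%:E).
  by apply: measurable_cvecP; exact: (measurable_expR_sqnorm L b).
(* The term [|x|^2 / Es] cancels the exponent of the prior, leaving a pure Gaussian centred at
   [b]. *)
transitivity (\int[@lebesgue_cvec R N]_x (c%:E * (expR (- sqnorm (L *m x - b)))%:E))%E.
  apply: eq_integral => x _; rewrite awld_condE /input_pdf -/b -EFinM; congr EFin.
  rewrite mulrCA -expRD [RHS]mulrAC -expRD mulrC; congr (expR _ * _).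
  by rewrite mulrC addrK.
rewrite ge0_integralZl//.
rewrite ge0_integral_pushforward//; last exact: measurable_cvec.
rewrite preimage_setT [X in (_ * X)%E](integral_gauss_trig_tuple b tL L0) -EFinM.
congr EFin; rewrite /c -/D; have pi0 : pi != 0 :> R by rewrite gt_eqF// pi_gt0.
by field; rewrite !expf_neq0 ?(gt_eqF D0) ?(gt_eqF hEs).
Qed.

End awld_model.

(** * Evaluation of the information bound *)

Lemma has_mean_sqnorm d (T : measurableType d) (R : realType) (P : probability T R)
    n (u : T -> 'cV[R[i]]_n) (K : 'M[R[i]]_n) :
  has_cross P u u K -> has_mean P (fun w => sqnorm (u w)) (complex.Re (\tr K)).
Proof. by move=> /has_cross_dot[]. Qed.

Lemma thin_QL_gram (R : realType) m n (A Q : 'M[R[i]]_(m, n)) (L : 'M[R[i]]_n) :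
  thin_QL A Q L -> L^t* *m L = A^t* *m A.
Proof.
by move=> [-> QQ _ _]; rewrite adjmxM mulmxA -[_ *m Q^t* *m Q]mulmxA QQ mulmx1.
Qed.

Lemma augmented_gram (R : realType) M N (Es N0 : R) (H : 'M[R[i]]_(M, N)) :
  0 < Es -> 0 < N0 -> (augmented Es N0 H)^t* *m augmented Es N0 H =
  N0^-1%:C *: (H^t* *m H) + (Es^-1%:C)%:M.
Proof.
move=> Es0 N00; rewrite /augmented tr_col_mx map_row_mx mul_row_col.
rewrite adjmxZ adjmx_scalar -scalemxAl -scalemxAr scalerA -scalar_mxM -!rmorphM/=.
by rewrite -!invfM -!expr2 !sqr_sqrtr// ltW.
Qed.

Unset Implicit Arguments.

Theorem theorem2 (R : realType) (M nu k : nat)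
    (hnu : (1 <= nu)%N) (hk : (1 <= k)%N) (hMN : (nu + k <= M)%N)
    (H : 'M[R[i]]_(M, nu + k)) (Es N0 : R) (hEs : 0 < Es) (hN0 : 0 < N0)
    (Qa : 'M[R[i]]_(M + (nu + k), nu + k)) (La : 'M[R[i]]_(nu + k))
    (hQL : thin_QL (augmented Es N0 H) Qa La)
    (d : measure_display) (Omega : measurableType d) (P : probability Omega R)
    (x : {RV P >-> 'cV[R[i]]_(nu + k)}) (n : {RV P >-> 'cV[R[i]]_M})
    (hx : cgauss_law x (Es%:C)%:M) (hn : cgauss_law n (N0%:C)%:M)
    (hxn : independent_RV x n) :
  let Lap := L_ap La in
  let Gap := Lap^t* *m Lap in
  let Fap := (mmse_mx (N0 / Es) H)^t* *m Gap in
  let y := fun w : Omega => H *m x w + n w in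
  info_lower_bound P x y (awld_cond Es Fap Gap) (awld_marg Es Fap Gap) =
  ((nu + k)%:R * ln Es + ln (complex.Re (\det (Lap^t* *m Lap))))%:E.
Proof.
move=> Lap Gap Fap y.
have [_ _ tLa La0] := hQL.
(* Passing to Gram matrices eliminates [Qa] and identifies [La^* La] with the matrix [J] of the MMSE
   identities. *)
have JE := thin_QL_gram hQL; rewrite augmented_gram// in JE.
have uLa := unitmx_trig tLa La0.
have uLa' : La^t* \in unitmx by rewrite map_unitmx unitmx_tr.
have uJ : La^t* *m La \in unitmx by rewrite unitmx_mul uLa' uLa.
have tL : is_trig_mx Lap := L_ap_trig tLa La0.
have L0 : forall i, 0 < Lap i i := L_ap_diag_gt0 tLa La0.
set mm := mmse_mx (N0 / Es) H in Fap *.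
set K := invmx (La^t* *m La).
have cxx := has_cross_cgauss hEs hx; have cnn := has_cross_cgauss hN0 hn.
have cxn := has_cross_indep hEs hN0 hx hn hxn.
have cnx : has_cross P n x 0 by have := has_crossC cxn; rewrite trmx0 map_mx0.
pose B := - mm; pose A := Es^-1%:C *: K.
have eE w : x w - mm *m y w = A *m x w + B *m n w.
  rewrite /A -(mmse_error_signal hEs hN0 uJ JE) -/mm mulmxBl mul1mx mulNmx.
  by rewrite /y mulmxDr mulmxA opprD addrA.
have cee : has_cross P (fun w => A *m x w + B *m n w)
    (fun w => A *m x w + B *m n w) K.
  rewrite /K -(mmse_error_cov hEs hN0 uJ JE (erefl A) (erefl B)).
  have c1 := has_crossMr A (has_crossMl A cxx).
  have c2 := has_crossMr B (has_crossMl B cnn).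
  have := has_crossMr B (has_crossMl A cxn); rewrite mulmx0 mul0mx => c3.
  have := has_crossMr A (has_crossMl B cnx); rewrite mulmx0 mul0mx => c4.
  have := has_crossDl (has_crossDr c1 c3) (has_crossDr c4 c2).
  by rewrite addr0 add0r.
have me := has_mean_sqnorm (has_crossMr Lap (has_crossMl Lap cee)).
have mx := has_meanZ Es^-1 (has_mean_sqnorm cxx).
(* [Lap K Lap^* = W La (La^* La)^-1 La^* W^* = W W^*], whose trace is [nu + k]. *)
have trE : complex.Re (\tr (Lap *m K *m Lap^t*)) = (nu + k)%:R.
  rewrite {1}/Lap /L_ap -/(L_ap La) -/Lap [in X in _ *m X]/Lap /L_ap adjmxM.
  rewrite /K (mulmx_inv_mul _ _ uLa uLa').
  by rewrite (trace_W_ap tLa La0) -(rmorph_nat (real_complex R)).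
have trx : complex.Re (\tr ((Es%:C)%:M : 'M[R[i]]_(nu + k))) = Es * (nu + k)%:R.
  by rewrite mxtrace_scalar -rmorphMn /= mulr_natr.
rewrite trE in me; rewrite trx mulKf ?gt_eqF// in mx.
have cyy : has_cross P y y (H *m (Es%:C)%:M *m H^t* + (N0%:C)%:M).
  have c1 := has_crossMr H (has_crossMl H cxx).
  have := has_crossMl H cxn; rewrite mulmx0 => c3.
  have := has_crossMr H cnx; rewrite mul0mx => c4.
  have := has_crossDl (has_crossDr c1 c3) (has_crossDr c4 cnn).
  by rewrite addr0 add0r.
have cmm := has_crossMr mm (has_crossMl mm cyy).
have := has_mean_sqnorm (has_crossMr Lap (has_crossMl Lap cmm)).
(* Only the finiteness of [m], the mean of [|Lap M y|^2], matters: it occurs in both expectations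
   and cancels. *)
move: (complex.Re _) => m my.
(* The weighted error and the normalised signal energy both have mean [nu + k], with opposite
   signs. *)
have mcond : has_mean P (fun w => ln (awld_cond Es Fap Gap (y w) (x w))) m.
  have := has_meanD (has_meanD my (has_meanN me)) mx; rewrite subrK.
  congr has_mean; apply/funext => w.
  by rewrite awld_condE expRK -mulmxBr eE.
pose D := \prod_i complex.Re (Lap i i).
have D0 : 0 < D := prod_diag_trig_gt0 L0.
pose c := ln (Es ^+ (nu + k) * D ^+ 2).
have EsD0 : 0 < Es ^+ (nu + k) * D ^+ 2 by rewrite mulr_gt0// exprn_gt0.
have mmarg := has_meanD my (has_mean_cst P (- c)).
rewrite /info_lower_bound unlock (proj2 mcond).
have -> : (\int[P]_w lne (awld_marg Es Fap Gap (y w)) = (m - c)%:E)%E.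
  rewrite -(proj2 mmarg); apply: eq_integral => w _.
  rewrite awld_margE// -/D lne_EFin; last by rewrite divr_gt0 ?expR_gt0.
  by rewrite ln_div ?posrE ?expR_gt0// expRK.
rewrite det_gram_trig// -/D -EFinB opprB addrC subrK; congr EFin.
by rewrite /c lnM ?posrE ?exprn_gt0// lnXn// mulr_natl.
Qed.
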